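(* Let $\beta>1$ be irrational and let $\gamma=a\beta+c>1$, where $a,c\in\mathbb Q$ and $a+c\ne 1$. Then every finite nonnegative Borel measure $\mu$ on $X=[0,1)$ with $\mu\perp\lambda$ and $$(T_\beta)_*\mu=(T_\gamma)_*\mu=\mu$$ is of the form $\mu=t\delta_0$ for some $t\ge 0$.
   Context: $X=[0,1)$, and $\lambda$ is Lebesgue probability measure on $X$. For a real number $b>1$, the beta-transformation $T_b:X\to X$ is $T_b(x)=bx-\lfloor bx\rfloor$. For a Borel map $F:X\to X$, $F_*\mu$ denotes the pushforward, $F_*\mu(E)=\mu(F^{-1}E)$. $\mu\perp\lambda$ means that $\mu$ is singular with respect to $\lambda$, i.e. carried by a Borel set of Lebesgue measure zero. $\delta_0$ is the unit point mass at $0$. *)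

(* Defs.v *)
From HB Require Import structures.
From mathcomp Require Import all_boot all_order all_algebra.
From mathcomp Require Import all_classical all_reals all_analysis.

Set Implicit Arguments.
Unset Strict Implicit.
Unset Printing Implicit Defensive.

Import Order.TTheory GRing.Theory Num.Theory.
Import numFieldNormedType.Exports.

Local Open Scope classical_set_scope.
Local Open Scope ring_scope.

Definition X (R : realType) : Type := set_type (`[0%R, 1%R[%classic : set R).

Lemma mem_itv01 (R : realType) (x : R) :
  0 <= x < 1 -> x \in (`[0%R, 1%R[%classic : set R).
Proof. by move=> hx; apply/mem_set; rewrite /= in_itv. Qed.

Definition inX (R : realType) (x : R) (hx : 0 <= x < 1) : X R :=
  exist _ x (mem_itv01 hx).

Definition zeroX (R : realType) : X R :=
  inX (introT andP (conj (lexx 0) ltr01)).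

(* The topology on X is the one the library puts on a [set_type], i.e. the
   subspace topology inherited from R. *)
HB.instance Definition _ (R : realType) :=
  Topological.copy (X R) (set_type (`[0%R, 1%R[%classic : set R)).
HB.instance Definition _ (R : realType) := isPointed.Build (X R) (zeroX R).

Definition borelX (R : realType) := g_sigma_algebraType (@open (X R)).

Definition valX (R : realType) (x : borelX R) : R := \val (x : X R).

Lemma frac_itv (R : realType) (y : R) : 0 <= y - (Num.floor y)%:~R < 1.
Proof.
have /andP[h1 h2] := floor_itv y.
by rewrite subr_ge0 h1 /= ltrBlDl -[X in _ + X]/(1%:~R) -intrD.
Qed.

Definition beta_map (R : realType) (b : R) (x : borelX R) : borelX R :=
  inX (frac_itv (b * valX x)).

Lemma measurable_valX (R : realType) (E : set (borelX R)) :
  measurable E -> exists2 B : set R, measurable B & E = @valX R @^-1` B.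
Proof.
pose G := preimage_set_system [set: X R] (@valX R) (@measurable _ R).
suff : <<s @open (X R) >> `<=` G by move=> h /h [B mB <-]; exists B; rewrite ?setTI.
apply: smallest_sub.
  by apply: sigma_algebra_preimage; exact: sigma_algebra_measurable.
move=> U [V oV <-]; exists V; last by rewrite setTI.
exact: measurable_realfun.open_measurable.
Qed.

Lemma image_valX (R : realType) (B : set R) :
  @valX R @` (@valX R @^-1` B) = B `&` `[0%R, 1%R[%classic.
Proof.
apply/seteqP; split=> [_ [x Bx <-]|y [By Iy]].
  by split=> //; exact: set_mem (valP (x : X R)).
by exists (exist _ y (mem_set Iy) : X R).
Qed.

Lemma measurable_image_valX (R : realType) (E : set (borelX R)) :
  measurable E -> measurable (@valX R @` E).
Proof.
move=> /measurable_valX [B mB ->]; rewrite image_valX.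
exact: measurableI.
Qed.

Lemma valX_inj (R : realType) : injective (@valX R).
Proof. exact: val_inj. Qed.

Definition lebX (R : realType) (E : set (borelX R)) : \bar R :=
  lebesgue_measure (@valX R @` E).

Section lebX.
Context (R : realType).

Let lebX0 : lebX (@set0 (borelX R)) = 0%E.
Proof. by rewrite /lebX image_set0 measure0. Qed.

Let lebX_ge0 (E : set (borelX R)) : (0 <= lebX E)%E.
Proof. exact: measure_ge0. Qed.

Let lebX_sigma_additive : semi_sigma_additive (@lebX R).
Proof.
move=> F mF tF mUF; rewrite /lebX image_bigcup.
apply: (@measure_semi_sigma_additive _ _ _ (@lebesgue_measure R)
  (fun n => @valX R @` F n)) => [n||].
- exact: measurable_image_valX.
- move=> i j _ _ [_ [[x Fx <-] [y Fy /valX_inj xy]]].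
  by apply: tF => //; exists x; split=> //; rewrite -xy.
- by rewrite -image_bigcup; exact: measurable_image_valX.
Qed.

HB.instance Definition _ := isMeasure.Build _ _ _ (@lebX R)
  lebX0 lebX_ge0 lebX_sigma_additive.

Let lebX_setT : lebX [set: borelX R] = 1%E.
Proof.
rewrite /lebX -(preimage_setT (@valX R)) image_valX setTI lebesgue_measure_itv /=.
by rewrite lte_fin ltr01 oppr0 adde0.
Qed.

HB.instance Definition _ :=
  Measure_isProbability.Build _ _ _ (@lebX R) lebX_setT.

End lebX.

Definition singular d (T : measurableType d) (R : realType)
    (mu nu : {measure set T -> \bar R}) : Prop :=
  exists E : set T, [/\ measurable E, nu E = 0%E & mu (~` E) = 0%E].

(* The value of a library measure is only meaningful on measurable sets, so
   equality of measures is equality there. *)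
Definition eq_meas d (T : measurableType d) (R : realType)
    (mu nu : set T -> \bar R) : Prop :=
  forall E : set T, measurable E -> mu E = nu E.

(* Main.v *)
(* Write [q gamma = p beta + r] with integers [p, q, r], [q > 0], and let
   [K = floor (beta x)], [L = floor (gamma x)]. Modulo 1,
   [q T_beta (T_gamma x) = q beta gamma x - q L beta] and
   [q T_gamma (T_beta x) = q beta gamma x - p K beta], and both have the law of
   [q x]. So moving the point [q beta gamma x] of the circle by [- q L] or by
   [- p K] steps of the rotation by [beta] leads to the same law. Count the
   visits made along these two walks: the difference of the two occupation
   measures is a signed measure invariant under the irrational rotation, hence
   a multiple of Lebesgue measure. It is also singular, as [mu] is, hence it
   vanishes, and its total mass [int (p K - q L) dmu] is 0. As
   [K = beta x - T_beta x] and [L = gamma x - T_gamma x], this integral is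
   [(q - p - r) int x dmu], where [q <> p + r] because [a + c <> 1]. So
   [int x dmu = 0], i.e. [mu] is carried by [0]. *)
Require Import Defs.
From HB Require Import structures.
From mathcomp Require Import all_boot all_order all_algebra.
From mathcomp Require Import all_classical all_reals all_analysis.
From mathcomp Require Import measurable_realfun.
From mathcomp Require Import ring lra zify.

Import Order.TTheory GRing.Theory Num.Theory.
Import numFieldNormedType.Exports.

Local Open Scope classical_set_scope.
Local Open Scope ring_scope.

(** * Density of [Z + Z b] in the line for irrational [b] *)

Lemma irrational_int_comb {R : realType} (b : R) (m n : int) :
  irrational b -> n != 0 -> m%:~R + n%:~R * b != 0.
Proof.
move=> hb n0; apply/eqP => h; apply: hb.
have n0' : n%:~R != 0 :> R by rewrite intr_eq0.
exists (- m%:~R / n%:~R) => //; rewrite fmorph_div/= rmorphN/= !ratr_int.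
by apply: (mulIf n0'); rewrite mulfVK// mulrC; lra.
Qed.

(** Euclid's algorithm on [1] and a small combination [g]: the remainder [r] of [1] by [g] satisfies
    [0 < r < g], so one of [r] and [g - r] is at most [g / 2]. Carrying [n != 0] along keeps each
    remainder nonzero by irrationality. *)
Lemma int_comb_small {R : realType} (b : R) (k : nat) : irrational b ->
  exists m n : int, n != 0 /\ 0 < m%:~R + n%:~R * b <= 2^-1 ^+ k.
Proof.
move=> hb; elim: k => [|k [m [n [n0 /andP[g0 gk]]]]].
  exists (- Num.floor b), 1; split=> //.
  have /andP[f0 f1] := frac_itv b.
  have := irrational_int_comb b (- Num.floor b) 1 hb isT.
  rewrite expr0 rmorphN mul1r addrC => h.
  by rewrite lt_neqAle f0 eq_sym h (ltW f1).
set g := m%:~R + n%:~R * b in g0 gk.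
have g1 : g <= 1.
  by apply: (le_trans gk); rewrite exprn_ile1 ?invr_ge0 ?invf_le1 ?ler1n.
pose q := Num.floor g^-1.
have q1 : 1 <= q by rewrite floor_ge_int// mulr1z invr_ge1 ?unitfE ?gt_eqF.
have /andP[q_le q_gt] := floor_itv g^-1.
rewrite -/q in q_le q_gt.
pose r := 1 - q%:~R * g.
have r0 : 0 <= r by rewrite subr_ge0 -ler_pdivlMr// mul1r.
have rg : r < g.
  rewrite /r ltrBlDr -[X in X + _]mul1r -mulrDl -ltr_pdivrMr// mul1r.
  by rewrite addrC -[X in _ < _ + X]/(1%:~R) -intrD.
have rE : r = (1 - q * m)%:~R + (- (q * n))%:~R * b.
  by rewrite /r /g rmorphB rmorphN !rmorphM/=; ring.
have qn0 : - (q * n) != 0 by rewrite oppr_eq0 mulf_eq0 negb_or n0 andbT gt_eqF ?(lt_le_trans ltr01).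
have rgt0 : 0 < r by rewrite lt_neqAle r0 andbT eq_sym rE irrational_int_comb.
rewrite exprS; have [rs|rs] := lerP r (2^-1 * g).
  exists (1 - q * m), (- (q * n)); split=> //; rewrite -rE rgt0/=.
  by apply: (le_trans rs); rewrite ler_pM2l ?invr_gt0.
(* Here [g - r] is the small one; its coefficient of [b] is [(1 + q) n], nonzero since [q >= 1]. *)
exists (m - (1 - q * m)), (n + q * n); split.
  by rewrite -[X in X + _]mul1r -mulrDl mulf_neq0// gt_eqF// ltr_wpDr// (le_trans ler01).
have -> : (m - (1 - q * m))%:~R + (n + q * n)%:~R * b = g - r.
  by rewrite rE /g !rmorphB rmorphD rmorphN !rmorphM/=; ring.
by apply/andP; split; lra.
Qed.

(** The multiples of a combination [g] with [0 < g < e] form a grid of mesh below [e]; the witness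
    is the last grid point not exceeding [x]. *)
Lemma int_comb_dense {R : realType} (b x e : R) : irrational b -> 0 < e ->
  exists m n : int, x - e < m%:~R + n%:~R * b <= x.
Proof.
move=> hb e0.
have [k ke] : exists k, 2^-1 ^+ k < e.
  have h : (2^-1 : R) ^+ k @[k --> \oo] --> 0.
    by apply: cvg_expr; rewrite ger0_norm ?invr_ge0 ?invf_lt1 ?ltr1n.
  have /cvgrPdist_lt/(_ _ e0)[N _ /(_ N (leqnn N))] := h.
  by rewrite sub0r normrN ger0_norm ?exprn_ge0 ?invr_ge0//; exists N.
have [m [n [_ /andP[g0 gk]]]] := int_comb_small b k hb.
set g := _ + _ in g0 gk.
pose q := Num.floor (x / g).
have /andP[q_le q_gt] := floor_itv (x / g).
exists (q * m), (q * n).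
have -> : (q * m)%:~R + (q * n)%:~R * b = q%:~R * g.
  by rewrite !rmorphM /g/=; ring.
rewrite -ler_pdivlMr// q_le andbT.
move: q_gt; rewrite ltr_pdivrMr// -/q intrD => q_gt.
lra.
Qed.

(** * Borel sets and null sets of the line *)

Lemma measurable_floor_comp {R : realType} d (T : measurableType d)
    (g : int -> T) :
  measurable_fun setT (fun x : R => g (Num.floor x)).
Proof.
move=> _ B _; rewrite setTI.
have -> : (fun x : R => g (Num.floor x)) @^-1` B =
    \bigcup_(k in g @^-1` B) `[k%:~R, (k + 1)%:~R[%classic.
  apply/seteqP; split=> x /=.
    by move=> gB; exists (Num.floor x) => //=; rewrite in_itv/= floor_itv.
  case=> k gB; rewrite /= in_itv/= => kx.
  by rewrite (floor_def kx).
by rewrite bigcup_mkcond; apply: countable_bigcupT_measurable => // k; case: ifP.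
Qed.

(** A ray from [x] is the intersection of rays from points of [A] that approach [x] from the left.
    Hence two measures need only be compared on rays with end points in a dense set, later
    [Z + Z b]. *)
Lemma measurable_dense_rays {R : realType} (A : set R) :
  (forall x e, 0 < e -> exists2 a, A a & x - e < a <= x) ->
  @measurable _ (measurableTypeR R) = <<s [set `[a, +oo[%classic | a in A] >>.
Proof.
move=> hA; rewrite [LHS](RGenCInfty.measurableE R); apply/seteqP; split.
  apply: smallest_sub; first exact: smallest_sigma_algebra.
  move=> _ [x ->].
  have /choice[a ha] : forall n : nat, exists a, A a /\ x - n.+1%:R^-1 < a <= x.
    by move=> n; have [|a] := hA x n.+1%:R^-1; [rewrite invr_gt0|exists a].
  have -> : `[x, +oo[%classic = \bigcap_n `[a n, +oo[%classic.
    apply/seteqP; split=> y /=.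
      rewrite in_itv/= andbT => xy n _ /=; rewrite in_itv/= andbT.
      by have [_ /andP[_ /le_trans]] := ha n; apply.
    move=> h; rewrite in_itv/= andbT; apply/ler_addgt0Pr => e e0.
    have [n _ /(_ n (leqnn n))/= ne] := near_infty_natSinv_lt (PosNum e0).
    have := h n I; rewrite /= in_itv/= andbT.
    have [_ /andP[h1 _]] := ha n => h2.
    by rewrite -lerBlDr; apply: ltW; apply: lt_le_trans h2; apply: le_lt_trans h1; rewrite lerD2l lerN2 ltW.
  apply: (@bigcapT_measurable _ (g_sigma_algebraType _)) => n.
  by apply: sub_sigma_algebra; exists (a n) => //; have [] := ha n.
apply: smallest_sub; first exact: smallest_sigma_algebra.
by move=> _ [a _ <-]; apply: sub_sigma_algebra; exists a.
Qed.

(** By uniqueness on half-open intervals, Lebesgue measure is [a] times its own image under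
    [y -> a y + b]. *)
Lemma lebesgue_null_affine {R : realType} (a b : R) (B : set R) :
  0 < a -> measurable B -> lebesgue_measure B = 0%E ->
  lebesgue_measure ((fun y => a * y + b) @^-1` B) = 0%E.
Proof.
move=> a0 mB B0.
pose f : measurableTypeR R -> measurableTypeR R := fun y => a * y + b.
have mf : measurable_fun setT f.
  by apply: measurable_funD => //; apply: measurable_funM.
pose nu := mscale (NngNum (ltW a0))
  (measure_function_pushforward__canonical__measure_function_Measure
    (@lebesgue_measure R) mf).
have nuE A : nu A = (a%:E * lebesgue_measure (f @^-1` A))%E by [].
have : lebesgue_measure B = nu B.
  apply: lebesgue_measure_unique => // _ [[u v] _ <-].
  rewrite [RHS]nuE.
  have -> : f @^-1` `]u, v] = `](u - b) / a, (v - b) / a]%classic.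
    apply/seteqP; split=> y /=;
      by rewrite !in_itv/= ltr_pdivrMr// ler_pdivlMr// ltrBlDr lerBrDr [y * a]mulrC.
  rewrite !lebesgue_measure_itv/= !lte_fin ltr_pM2r ?invr_gt0// ltrD2r.
  case: ifPn => _; last by rewrite mule0.
  by rewrite -!EFinB -EFinM; congr EFin; field; rewrite gt_eqF.
rewrite B0 nuE => /esym/eqP.
by rewrite mule_eq0 eqe gt_eqF//= => /eqP.
Qed.

(** * Quasi-periods and the crossing cocycle *)

Lemma add_periods {R : realType} (f : R -> R) (s g : R) :
  (forall t, f (t + s) = f t + g) ->
  forall (k : int) t, f (t + k%:~R * s) = f t + k%:~R * g.
Proof.
move=> h.
have hn (n : nat) t : f (t + n%:R * s) = f t + n%:R * g.
  elim: n => [|n IH]; first by rewrite !mul0r !addr0.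
  by rewrite -natr1 !mulrDl !mul1r !addrA h IH.
case=> n t; first exact: hn.
rewrite NegzE rmorphN/= !mulNr -[n.+1%:~R]/(n.+1%:R).
by rewrite -[in RHS](subrK (n.+1%:R * s) t) hn addrK.
Qed.

Lemma natmul_bounded_eq0 {R : realType} (x C : R) :
  (forall n : nat, `|n%:R * x| <= C) -> x = 0.
Proof.
move=> h; apply/eqP; apply: contraT => x0.
have C0 : 0 <= C by apply: le_trans (h 0%N).
have xp : 0 < `|x| by rewrite normr_gt0.
have := h (Num.truncn (C / `|x|)).+1; rewrite normrM normr_nat.
by rewrite leNgt -ltr_pdivrMr// truncnS_gt.
Qed.

(* For [0 <= t], the number of integers in [(z - t, z]]; as a function of the
   class of [z] modulo 1 and for [t <= 1], the indicator of [[0, t)]. *)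
Definition crossings {R : realType} (t z : R) : R :=
  (Num.floor z - Num.floor (z - t))%:~R.

(** The integer parts at [z], [z - s] and [z - s - t] telescope. This cocycle identity trades
    addition in [t] for translation in [z]. *)
Lemma crossingsD {R : realType} (s t z : R) :
  crossings (t + s) z = crossings s z + crossings t (z - s).
Proof.
rewrite /crossings -rmorphD; congr (_%:~R).
by have -> : z - (t + s) = z - s - t; [ring|lia].
Qed.

Lemma crossings1 {R : realType} (z : R) : crossings 1 z = 1.
Proof.
rewrite /crossings -[X in z - X]/((1%:Z)%:~R) -rmorphN floorDrz ?intr_int//.
by rewrite intrKfloor opprD opprK addrA subrr add0r.
Qed.

Lemma crossings_periodic {R : realType} (t z : R) (k : int) :
  crossings t (z + k%:~R) = crossings t z.
Proof.
have h (y : R) : Num.floor (y + k%:~R) = Num.floor y + k.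
  by rewrite floorDrz ?intr_int// intrKfloor.
by rewrite /crossings addrAC !h opprD addrACA subrr addr0.
Qed.

Lemma crossings_le {R : realType} (t z : R) : `|crossings t z| <= `|t| + 1.
Proof.
rewrite /crossings rmorphB/=.
have /andP[] := frac_itv z; have /andP[] := frac_itv (z - t).
move: (_%:~R) (_%:~R) => u v h1 h2 h3 h4.
by rewrite ler_norml; have := ler_norm t; have := ler_norm (- t); rewrite normrN; lra.
Qed.

(** Subtracting [a] lowers the integer part of [z] by one exactly when the fractional part is below
    [a]. This links [crossings] to rays, which generate the Borel sets. *)
Lemma crossings_indic {R : realType} (a z : R) : 0 <= a <= 1 ->
  \1_(`[a, +oo[%classic) (z - (Num.floor z)%:~R) = 1 - crossings a z :> R.
Proof.
move=> /andP[a0 a1]; rewrite indicE /crossings.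
have /andP[f0 f1] := frac_itv z; have [az|az] := leP a (z - (Num.floor z)%:~R).
  rewrite mem_set; last by rewrite /= in_itv/= andbT.
  have -> : Num.floor (z - a) = Num.floor z.
    by apply: floor_def; rewrite intrD; lra.
  by rewrite subrr subr0.
rewrite memNset; last by rewrite /= in_itv/= andbT leNgt az.
have -> : Num.floor (z - a) = Num.floor z - 1.
  by apply: floor_def; rewrite subrK intrB; lra.
by rewrite opprB addrCA subrr addr0 subrr.
Qed.

Lemma measurable_crossings {R : realType} (t : R) :
  measurable_fun setT (crossings t).
Proof.
have -> : crossings t =
    (fun z => (Num.floor z)%:~R) \- (fun z => (Num.floor (z - t))%:~R).
  by apply/funext => z; rewrite /crossings rmorphB.
apply: measurable_funB; first exact: (@measurable_floor_comp R _ R intr).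
apply: (measurableT_comp (@measurable_floor_comp R _ R intr)).
exact: measurable_funB.
Qed.

(** * Sums along finite orbits of the translation by [b] *)

Definition orbit_sum {R : realType} (b : R) (m : nat) (phi : R -> R) (z : R) : R :=
  \sum_(j < m) phi (z + j%:R * b).

(** The points counted are [z, ..., z + (m - 1) b], so shifting by [b] gains the end point [z + m b]
    and loses the start [z]. *)
Lemma orbit_sum_shift {R : realType} (b : R) m (phi : R -> R) z :
  orbit_sum b m (fun y => phi (y + b)) z - orbit_sum b m phi z =
  phi (z + m%:R * b) - phi z.
Proof.
rewrite /orbit_sum; elim: m => [|m IH]; first by rewrite !big_ord0 mul0r addr0 !subrr.
rewrite !big_ord_recr/= -natr1 mulrDl mul1r addrA.
by rewrite opprD addrACA IH addrC addrA subrK.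
Qed.

(** With a fixed number [M] of terms the sum can be treated term by term when [m] varies with the
    point. *)
Lemma orbit_sum_widen {R : realType} (b : R) (m M : nat) (phi : R -> R) z :
  (m <= M)%N ->
  orbit_sum b m phi z = \sum_(j < M) (j < m)%N%:R * phi (z + j%:R * b).
Proof.
move=> mM; rewrite /orbit_sum (big_ord_widen M (fun j => phi (z + j%:R * b)))//.
by rewrite big_mkcond/=; apply: eq_bigr => j _; case: ifP; rewrite ?mul1r ?mul0r.
Qed.

Lemma bounded_integrable d (T : measurableType d) {R : realType}
    (mu : {finite_measure set T -> \bar R}) (f : T -> R) (C : R) :
  measurable_fun setT f -> (forall x, `|f x| <= C) ->
  mu.-integrable setT (EFin \o f).
Proof.
move=> mf fC; apply: measurable_bounded_integrable => //.
  by rewrite -ge0_fin_numE ?fin_num_measure.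
exists C; split; first exact: num_real.
by move=> D CD x _ /=; apply: le_trans (fC x) (ltW CD).
Qed.

(** * Difference of the occupation measures of two walks *)

Section discrepancy.
Context {d} {T : measurableType d} {R : realType}
  (mu : {finite_measure set T -> \bar R}) (b : R) (M : nat)
  (Z : T -> R) (mZ : measurable_fun setT Z).
Implicit Types (m : T -> nat) (phi psi : R -> R).

Definition bounded_length m :=
  measurable_fun setT m /\ forall x, (m x <= M)%N.

Definition bounded_measurable phi :=
  measurable_fun setT phi /\ exists C, forall z, `|phi z| <= C.

Lemma bounded_measurable_translate phi s :
  bounded_measurable phi -> bounded_measurable (fun z => phi (z + s)).
Proof.
move=> [mphi [C hC]]; split; last by exists C => z; exact: hC.
by apply: (measurableT_comp mphi); exact: measurable_funD.
Qed.

Lemma bounded_measurable_crossings t : bounded_measurable (crossings t).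
Proof.
by split; [exact: measurable_crossings|exists (`|t| + 1) => z; exact: crossings_le].
Qed.

Lemma measurable_orbit_sum m phi : bounded_length m ->
  measurable_fun setT phi ->
  measurable_fun setT (fun x => orbit_sum b (m x) phi (Z x)).
Proof.
move=> [mm mM] mphi.
have -> : (fun x => orbit_sum b (m x) phi (Z x)) =
    (fun x => \sum_(j < M) (j < m x)%N%:R * phi (Z x + j%:R * b)).
  by apply/funext => x; exact: orbit_sum_widen.
apply: measurable_sum => j; apply: measurable_funM.
  apply: (measurableT_comp (f := fun n : nat => (j < n)%N%:R : R) (g := m)) => //.
by apply: (measurableT_comp mphi); exact: measurable_funD.
Qed.

Lemma orbit_sum_le m phi C : (forall x, (m x <= M)%N) ->
  (forall z, `|phi z| <= C) ->
  forall x, `|orbit_sum b (m x) phi (Z x)| <= M%:R * C.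
Proof.
move=> mM hC x; apply: (le_trans (ler_norm_sum _ _ _)).
have C0 : 0 <= C by apply: le_trans (hC 0).
apply: (@le_trans _ _ (\sum_(j < m x) C)); first exact: ler_sum.
by rewrite sumr_const card_ord -[C *+ _]mulr_natl ler_wpM2r// ler_nat.
Qed.

Lemma integrable_orbit_sum m phi : bounded_length m -> bounded_measurable phi ->
  mu.-integrable setT (EFin \o (fun x => orbit_sum b (m x) phi (Z x))).
Proof.
move=> hm [mphi [C hC]]; apply: (@bounded_integrable _ _ _ _ _ (M%:R * C)).
  exact: measurable_orbit_sum.
by apply: orbit_sum_le => //; case: hm.
Qed.

(** This integrates [phi] against the occupation measure of the walk that starts at [Z x] and makes
    [m x] steps of size [b], end point excluded. *)
Definition orbit_mean m phi : R := \int[mu]_x orbit_sum b (m x) phi (Z x).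

Lemma orbit_meanD m phi psi : bounded_length m ->
  bounded_measurable phi -> bounded_measurable psi ->
  orbit_mean m (fun z => phi z + psi z) = orbit_mean m phi + orbit_mean m psi.
Proof.
move=> hm hphi hpsi; rewrite /orbit_mean -RintegralD//; try exact: integrable_orbit_sum.
by apply: eq_Rintegral => x _; rewrite /orbit_sum big_split.
Qed.

Lemma orbit_mean_le m phi C : bounded_length m -> measurable_fun setT phi ->
  (forall z, `|phi z| <= C) ->
  `|orbit_mean m phi| <= M%:R * C * fine (mu setT).
Proof.
move=> hm mphi hC.
have hphi : bounded_measurable phi by split=> //; exists C.
have mM : forall x, (m x <= M)%N by case: hm.
apply: le_trans (le_normr_Rintegral _ _) _ => //; first exact: integrable_orbit_sum.
rewrite -Rintegral_cst//; apply: le_Rintegral => //.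
- exact/integrable_norm/integrable_orbit_sum.
- by apply: (@bounded_integrable _ _ _ _ _ (`|M%:R * C|)).
- by move=> x _; exact: orbit_sum_le.
Qed.

(** Periodic test functions see only classes modulo 1, so the laws are compared on the circle. *)
Definition same_endpoint_law m1 m2 :=
  forall phi, bounded_measurable phi ->
    (forall z (k : int), phi (z + k%:~R) = phi z) ->
    \int[mu]_x phi (Z x + (m1 x)%:R * b) = \int[mu]_x phi (Z x + (m2 x)%:R * b).

Lemma integrable_endpoint m phi : bounded_length m -> bounded_measurable phi ->
  mu.-integrable setT (EFin \o (fun x => phi (Z x + (m x)%:R * b))).
Proof.
move=> [mm _] [mphi [C hC]]; apply: (@bounded_integrable _ _ _ _ _ C) => //.
apply: (measurableT_comp mphi); apply: measurable_funD => //.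
apply: measurable_funM => //.
by apply: (measurableT_comp (f := fun n : nat => n%:R : R) (g := m)).
Qed.

Lemma orbit_mean_shift m phi : bounded_length m -> bounded_measurable phi ->
  orbit_mean m (fun z => phi (z + b)) - orbit_mean m phi =
  \int[mu]_x phi (Z x + (m x)%:R * b) - \int[mu]_x phi (Z x).
Proof.
move=> hm hphi; rewrite /orbit_mean.
have i1 := integrable_endpoint m phi hm hphi.
have i2 : mu.-integrable setT (EFin \o (fun x => phi (Z x))).
  case: hphi => mphi [C hC]; apply: (@bounded_integrable _ _ _ _ _ C) => //.
  exact: measurableT_comp.
have i3 := integrable_orbit_sum m phi hm hphi.
have i4 := integrable_orbit_sum m _ hm (bounded_measurable_translate phi b hphi).
rewrite -!RintegralB//.
by apply: eq_Rintegral => x _; exact: orbit_sum_shift.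
Qed.

Context (m1 m2 : T -> nat) (hm1 : bounded_length m1) (hm2 : bounded_length m2)
  (hlaw : same_endpoint_law m1 m2).

Definition discrepancy phi := orbit_mean m1 phi - orbit_mean m2 phi.

(** Both walks start at [Z x], so the start terms of [orbit_mean_shift] cancel; the end terms cancel
    by [hlaw]. *)
Lemma discrepancy_shift phi : bounded_measurable phi ->
  (forall z (k : int), phi (z + k%:~R) = phi z) ->
  discrepancy (fun z => phi (z + b)) = discrepancy phi.
Proof.
move=> hphi pphi; rewrite /discrepancy.
have := orbit_mean_shift m1 phi hm1 hphi.
have := orbit_mean_shift m2 phi hm2 hphi.
by rewrite hlaw//; lra.
Qed.

Lemma discrepancyD phi psi : bounded_measurable phi -> bounded_measurable psi ->
  discrepancy (fun z => phi z + psi z) = discrepancy phi + discrepancy psi.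
Proof. by move=> *; rewrite /discrepancy !orbit_meanD//; lra. Qed.

Lemma discrepancy_crossings1 t :
  discrepancy (crossings (t + 1)) =
  discrepancy (crossings t) + discrepancy (fun=> 1).
Proof.
rewrite -discrepancyD; first last.
- by split=> //; exists 1 => _; rewrite normr1.
- exact: bounded_measurable_crossings.
congr discrepancy; apply/funext => z.
rewrite crossingsD crossings1 -(crossings_periodic t z (-1)) rmorphN/= mulr1z.
by rewrite addrC.
Qed.

(** The cocycle identity produces [crossings t (z - b)], and rotation invariance removes its
    translation. *)
Lemma discrepancy_crossingsb t :
  discrepancy (crossings (t + b)) =
  discrepancy (crossings t) + discrepancy (crossings b).
Proof.
have bt := bounded_measurable_crossings t.
have btb := bounded_measurable_translate _ (- b) bt.
have -> : discrepancy (crossings t) = discrepancy (fun z => crossings t (z - b)).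
  rewrite -(discrepancy_shift _ btb).
    by congr discrepancy; apply/funext => z; rewrite addrK.
  by move=> z k; rewrite addrAC crossings_periodic.
rewrite -discrepancyD//; last exact: bounded_measurable_crossings.
by congr discrepancy; apply/funext => z; rewrite crossingsD addrC.
Qed.

Lemma discrepancy_crossings_le t :
  `|discrepancy (crossings t)| <= 2 * (M%:R * (`|t| + 1) * fine (mu setT)).
Proof.
apply: (le_trans (ler_normB _ _)); rewrite mulr_natl mulr2n.
by apply: lerD; apply: orbit_mean_le => //;
  [exact: measurable_crossings|exact: crossings_le|
   exact: measurable_crossings|exact: crossings_le].
Qed.

(** [G] has quasi-periods [1] and [b] with increments [c] and [G b], so only [G b = b c] is at
    stake. For [t] the fractional part of [n b], [n (G b - b c) = G t - t c], which is bounded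
    uniformly in [n]; hence [G b - b c] vanishes. *)
Lemma discrepancy_crossings_int_comb (p q : int) :
  discrepancy (crossings (p%:~R + q%:~R * b)) =
  (p%:~R + q%:~R * b) * discrepancy (fun=> 1).
Proof.
pose G t := discrepancy (crossings t).
set c := discrepancy (fun=> 1).
have Gb := add_periods G b (G b) discrepancy_crossingsb.
have G1 k t : G (t + k%:~R) = G t + k%:~R * c.
  by rewrite -[in LHS](mulr1 (k%:~R)) (add_periods G 1 c discrepancy_crossings1).
have G0 : G 0 = 0.
  by apply: (addIr (G b)); rewrite -discrepancy_crossingsb !add0r.
have Gpq (u v : int) : G (u%:~R + v%:~R * b) = u%:~R * c + v%:~R * G b.
  by rewrite Gb -[in LHS](add0r (u%:~R)) G1 G0 add0r.
suff Gbc : G b = b * c by rewrite -/(G _) Gpq Gbc; ring.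
apply/eqP; rewrite -subr_eq0; apply/eqP.
(* The constant bounds [|G t| + |t c|] for [0 <= t < 1], where [|t| + 1 <= 2]. *)
apply: (@natmul_bounded_eq0 _ _ (2 * (M%:R * 2 * fine (mu setT)) + `|c|)) => n.
pose t := n%:R * b - (Num.floor (n%:R * b))%:~R.
have /andP[t0 t1] := frac_itv (n%:R * b); rewrite -/t in t0 t1.
have tE : n%:R * (G b - b * c) = G t - t * c.
  have -> : t = (- Num.floor (n%:R * b))%:~R + (n : int)%:~R * b.
    by rewrite /t rmorphN addrC.
  by rewrite Gpq /=; ring.
rewrite tE; apply: le_trans (ler_normB _ _) _; apply: lerD.
  apply: (le_trans (discrepancy_crossings_le t)).
  rewrite ler_pM2l// ler_wpM2r ?fine_ge0 ?measure_ge0// ler_wpM2l//.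
  by rewrite ger0_norm//; lra.
by rewrite normrM ger0_norm// ler_piMl// ltW.
Qed.
End discrepancy.

(** * Equal mean lengths for walks carried by a null set *)

Section equal_lengths.
Context {d} {T : measurableType d} {R : realType}
  (mu : {finite_measure set T -> \bar R}) (b : R) (M : nat)
  (Z : T -> R) (mZ : measurable_fun setT Z).

Definition fractional (z : R) : R := z - (Num.floor z)%:~R.

Lemma measurable_fractional : measurable_fun setT fractional.
Proof. by apply: measurable_funB => //; exact: (@measurable_floor_comp R _ R intr). Qed.

Lemma bounded_measurable_indic_fractional (B : set R) : measurable B ->
  @bounded_measurable R (fun z => \1_B (fractional z)).
Proof.
move=> mB; split.
  by apply: measurableT_comp; [exact: measurable_indic|exact: measurable_fractional].
by exists 1 => z; rewrite indicE; case: (_ \in _); rewrite ?normr1 ?normr0.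
Qed.

(** Restrict [mu] to the points with [j < m x], push it to the [j]-th point of the walk modulo 1,
    and sum over [j < M]. A genuine measure is needed to apply uniqueness of measures. *)
Lemma occupation_measure (m : T -> nat) : bounded_length M m ->
  exists J : {measure set (measurableTypeR R) -> \bar R},
    forall B, measurable B ->
      J B = (orbit_mean mu b Z m (fun z => \1_B (fractional z)))%:E.
Proof.
move=> hm; have [mm mM] := hm.
have mA (j : nat) : measurable [set x | (j < m x)%N].
  by rewrite -[X in measurable X]setTI; exact: (mm measurableT [set n | (j < n)%N]).
pose f (j : nat) : T -> measurableTypeR R := fun x => fractional (Z x + j%:R * b).
have mf j : measurable_fun setT (f j).
  by apply: (measurableT_comp measurable_fractional); exact: measurable_funD.
pose J := msum (fun j =>
  measure_function_pushforward__canonical__measure_function_Measure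
    (mrestr mu (mA j)) (mf j)) M.
exists J => B mB.
have JE : J B = (\sum_(j < M) mu (f j @^-1` B `&` [set x | (j < m x)%N]))%E by [].
have mfB j : measurable (f j @^-1` B `&` [set x | (j < m x)%N]).
  by apply: measurableI => //; have := mf j measurableT B mB; rewrite setTI.
have hB := bounded_measurable_indic_fractional B mB.
rewrite /orbit_mean /Rintegral fineK; last first.
  by apply: integrable_fin_num => //; exact: integrable_orbit_sum.
rewrite [LHS]JE.
under [RHS]eq_integral => x _.
  rewrite (orbit_sum_widen _ _ M)// -sumEFin.
  under eq_bigr => j _.
    have -> : (j < m x)%N%:R * \1_B (fractional (Z x + j%:R * b)) =
        \1_(f j @^-1` B `&` [set x | (j < m x)%N]) x :> R.
      rewrite indicI/= mulrC; congr (_ * _); rewrite indicE.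
      by have [jm|jm] := boolP (j < m x)%N; [rewrite mem_set|rewrite memNset//; exact/negP].
    over.
  over.
rewrite ge0_integral_sum//.
  by apply: eq_bigr => j _; rewrite integral_indic// setIT.
by move=> j; apply/measurable_EFinP; exact: measurable_indic.
Qed.

(** Suppose the difference [c] of the mean lengths is positive. The occupation measures then satisfy
    [J1 = J2 + c lambda] on [[0, 1[], first on rays and then on Borel sets. On the null set [S],
    which carries both walks, this reads [c = 0]. Proving an inequality, so with [c > 0], keeps both
    sides nonnegative measures. *)
Lemma expected_length_le (m1 m2 : T -> nat) (A : set T) (S : set R) :
  irrational b -> bounded_length M m1 -> bounded_length M m2 ->
  same_endpoint_law mu b Z m1 m2 ->
  measurable A -> mu (~` A) = 0%E ->
  measurable S -> lebesgue_measure S = 0%E ->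
  (forall x, A x -> forall j : nat, S (fractional (Z x + j%:R * b))) ->
  \int[mu]_x (m1 x)%:R <= \int[mu]_x (m2 x)%:R.
Proof.
move=> hb hm1 hm2 hlaw mA A0 mS S0 AS.
have mean1 m : \int[mu]_x (m x)%:R = orbit_mean mu b Z m (fun=> 1).
  apply: eq_Rintegral => x _.
  by rewrite /orbit_sum sumr_const card_ord.
rewrite !mean1; set D := discrepancy mu b Z m1 m2.
suff : D (fun=> 1) <= 0 by rewrite subr_le0.
rewrite leNgt; apply/negP; set c := D (fun=> 1) => c0.
have [J1 J1E] := occupation_measure m1 hm1.
have [J2 J2E] := occupation_measure m2 hm2.
pose I01 : set R := `[0, 1[%classic.
have mI : measurable I01 by exact: measurable_itv.
pose nu : {measure set (measurableTypeR R) -> \bar R} :=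
  measure_add J2 (mscale (NngNum (ltW c0)) (mrestr (@lebesgue_measure R) mI)).
have nuE B : measurable B ->
    nu B = ((orbit_mean mu b Z m2 (fun z => \1_B (fractional z)))%:E
             + c%:E * lebesgue_measure (B `&` I01))%E.
  by move=> mB; rewrite -J2E//; exact: measure_addE.
pose Q := [set p%:~R + q%:~R * b | p in [set: int] & q in [set: int]] : set R.
have Qdense x e : 0 < e -> exists2 a, Q a & x - e < a <= x.
  move=> e0; have [p [q pq]] := int_comb_dense b x e hb e0.
  by exists (p%:~R + q%:~R * b) => //; exists p => //; exists q.
pose G := [set `[a, +oo[%classic | a in Q].
have JG B : G B -> J1 B = nu B.
  move=> [a [p _ [q _ aE]] <-].
  have mB : measurable (`[a, +oo[%classic : set R) by exact: measurable_itv.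
  rewrite J1E// nuE//.
  (* The discrepancy of a ray must be [c] times the length [l] of its part in [[0, 1[]; the cases
     are [a < 0], [a > 1] and [0 <= a <= 1]. *)
  suff [l lE DE] : exists2 l : R, lebesgue_measure (`[a, +oo[ `&` I01) = l%:E &
      D (fun z => \1_(`[a, +oo[%classic) (fractional z)) = c * l.
    by rewrite lE -EFinM -EFinD; congr EFin; rewrite -DE /D /discrepancy addrC subrK.
  have [a0|a0] := ltP a 0.
    exists 1.
      rewrite setIidr ?lebesgue_measure_itv/= ?lte_fin ?ltr01 ?oppr0 ?adde0//.
      by move=> y; rewrite /= !in_itv/= andbT => /andP[y0 _]; exact: ltW (lt_le_trans a0 y0).
    rewrite mulr1; congr D; apply/funext => z; rewrite indicE mem_set//.
    rewrite /= in_itv/= andbT; have /andP[f0 _] := frac_itv z.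
    exact: ltW (lt_le_trans a0 f0).
  have [a1|a1] := ltP 1 a.
    exists 0.
      rewrite (_ : _ `&` _ = set0) ?measure0//; apply/seteqP; split=> y //=.
      rewrite !in_itv/= andbT => -[ay /andP[_ y1]].
      by have := lt_trans (y1 : y < 1) a1; rewrite ltNge ay.
    rewrite mulr0 /D /discrepancy.
    have -> : (fun z : R => \1_(`[a, +oo[%classic) (fractional z)) = cst 0 :> (R -> R).
      apply/funext => z; rewrite indicE memNset//=.
      rewrite in_itv/= andbT; have /andP[_ f1] := frac_itv z.
      by apply/negP; rewrite -ltNge; exact: lt_trans f1 a1.
    rewrite /orbit_mean /orbit_sum.
    by under eq_Rintegral do rewrite big1//; under [X in _ - X]eq_Rintegral do rewrite big1//; rewrite subrr.
  exists (1 - a).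
    rewrite (_ : _ `&` _ = `[a, 1[%classic); last first.
      apply/seteqP; split=> y /=; rewrite !in_itv/= andbT.
        by move=> [-> /andP[_ y1]].
      by move=> /andP[ay y1]; split=> //; apply/andP; split=> //; exact: le_trans ay.
    rewrite lebesgue_measure_itv/= lte_fin; case: ltP => // a1'.
    by rewrite (@le_anti _ _ a 1 _) ?a1//= subrr.
  have hind := bounded_measurable_indic_fractional _ mB.
  have hcr := bounded_measurable_crossings a.
  (* The indicator of the ray and [crossings a] add up to 1, so the ray receives [c - a c]. *)
  have := discrepancyD mu b M Z mZ m1 m2 hm1 hm2 _ _ hind hcr.
  rewrite -/D.
  have -> : (fun z => \1_(`[a, +oo[%classic) (fractional z) + crossings a z) = cst 1 :> (R -> R).
    by apply/funext => z; rewrite crossings_indic ?a0// subrK.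
  rewrite -aE /D (discrepancy_crossings_int_comb mu b M Z mZ m1 m2)// -/D -/c.
  move: (D _) => u h; rewrite mulrBr mulr1 [c * _]mulrC; apply/eqP.
  by rewrite eq_sym subr_eq; apply/eqP.
(* Rays with end points in [Q] are stable under intersection, generate the Borel sets by density,
   and exhaust the line through the end points [- n]. *)
have Jeq : J1 S = nu S.
  apply: (@measure_unique _ R (measurableTypeR R) G
    (fun n => `[- n%:R, +oo[%classic) _ _ _ _ J1 nu) => //.
  - exact: measurable_dense_rays.
  - move=> _ _ [u Qu <-] [v Qv <-].
    exists (Num.max u v); first by rewrite /Num.max; case: ifP.
    by apply/seteqP; split=> y /=; rewrite !in_itv/= !andbT ge_max => /andP.
  - move=> n; exists (- n%:R) => //; exists (- (n : int)) => //; exists 0 => //.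
    by rewrite mul0r addr0 rmorphN.
  - apply/seteqP; split=> // y _; exists (Num.truncn (- y)).+1 => //=.
    by rewrite in_itv/= andbT lerNl ltW// truncnS_gt.
  - by move=> k; rewrite J1E ?ltry//.
(* For almost every [x] all points of the walk lie in [S] modulo 1, so the indicator of [S] counts
   every step. *)
have fullS m : bounded_length M m ->
    orbit_mean mu b Z m (fun z => \1_S (fractional z)) = orbit_mean mu b Z m (fun=> 1).
  move=> hm; congr fine; apply: ae_eq_integral => //.
  - apply/measurable_EFinP; apply: (measurable_orbit_sum b M) => //.
    by have [] := bounded_measurable_indic_fractional _ mS.
  - by apply/measurable_EFinP; apply: (measurable_orbit_sum b M).
  - exists (~` A); split=> //; first exact: measurableC.
    move=> x /= h Ax; apply: h => _; congr EFin; apply: eq_bigr => j _.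
    by rewrite indicE mem_set//; exact: AS.
have SI0 : lebesgue_measure (S `&` I01) = 0%E.
  apply/eqP; rewrite eq_le measure_ge0 andbT -S0 le_measure ?inE//.
  exact: measurableI.
move: Jeq; rewrite J1E// nuE// !fullS// SI0.
rewrite mule0 adde0 => -[h].
by have := c0; rewrite /c /D /discrepancy h subrr ltxx.
Qed.

Lemma expected_length_eq (m1 m2 : T -> nat) (A : set T) (S : set R) :
  irrational b -> bounded_length M m1 -> bounded_length M m2 ->
  same_endpoint_law mu b Z m1 m2 ->
  measurable A -> mu (~` A) = 0%E ->
  measurable S -> lebesgue_measure S = 0%E ->
  (forall x, A x -> forall j : nat, S (fractional (Z x + j%:R * b))) ->
  \int[mu]_x (m1 x)%:R = \int[mu]_x (m2 x)%:R.
Proof.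
move=> hb hm1 hm2 hlaw mA A0 mS S0 AS; apply/eqP; rewrite eq_le.
apply/andP; split; first exact: (@expected_length_le m1 m2 A S).
apply: (@expected_length_le m2 m1 A S) => // phi hphi pphi.
by rewrite hlaw.
Qed.
End equal_lengths.

(** * Measurability and invariant integrals for beta-transformations *)

Section beta_maps.
Context {R : realType}.
Implicit Types (b : R) (mu : {finite_measure set (borelX R) -> \bar R}).

Lemma measurable_fun_valX : measurable_fun setT (@valX R).
Proof.
apply: (measurability (@RGenOInfty.G R)); first exact: RGenOInfty.measurableE.
move=> _ [_ [a ->] <-]; rewrite setTI; apply: sub_sigma_algebra.
by exists `]a, +oo[%classic => //; exact: interval_open.
Qed.

Lemma valX_bounds (x : borelX R) : 0 <= valX x < 1.
Proof. by have := set_mem (valP (x : X R)); rewrite /= in_itv. Qed.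

Lemma measurable_beta_map b : measurable_fun setT (@beta_map R b).
Proof.
move=> _ E /measurable_valX[B mB ->]; rewrite setTI.
have mf : measurable_fun setT (fun x : borelX R => fractional (b * valX x)).
  apply: (measurableT_comp measurable_fractional).
  by apply: measurable_funM => //; exact: measurable_fun_valX.
by have := mf measurableT B mB; rewrite setTI.
Qed.

Lemma integral_beta_map b mu (f : borelX R -> R) (C : R) :
  eq_meas (pushforward mu (beta_map b)) mu ->
  measurable_fun setT f -> (forall x, `|f x| <= C) ->
  \int[mu]_x f (beta_map b x) = \int[mu]_x f x.
Proof.
move=> hinv mf fC; congr fine.
have mb := measurable_beta_map b.
transitivity (\int[pushforward mu (beta_map b)]_x (f x)%:E)%E; last first.
  by apply: eq_measure_integral => A mA _; exact: hinv.
rewrite (integral_pushforward mb)//; first exact/measurable_EFinP.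
apply: (@bounded_integrable _ _ _ _ _ C) => //.
exact: measurableT_comp.
Qed.

Lemma floor_mul_valX b (x : borelX R) : 0 <= b ->
  0 <= Num.floor (b * valX x) <= Num.floor b.
Proof.
move=> b0; have /andP[x0 x1] := valX_bounds x.
by rewrite floor_ge0 mulr_ge0//= le_floor// ler_piMr// ltW.
Qed.
End beta_maps.

(** * The two walks attached to a common invariant measure *)

Section common_invariant_measure.
Context {R : realType} (beta gamma : R) (p r : int) (q : nat).
Context (mu : {finite_measure set (borelX R) -> \bar R}).
Hypotheses (beta_gt0 : 0 < beta) (gamma_gt0 : 0 < gamma) (q_gt0 : (0 < q)%N).
Hypothesis beta_irr : irrational beta.
Hypothesis gammaE : q%:R * gamma = p%:~R * beta + r%:~R.
Hypothesis musing : singular mu (@lebX R).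
Hypothesis mu_beta : eq_meas (pushforward mu (beta_map beta)) mu.
Hypothesis mu_gamma : eq_meas (pushforward mu (beta_map gamma)) mu.

Let K (x : borelX R) := Num.floor (beta * valX x).
Let L (x : borelX R) := Num.floor (gamma * valX x).
(** [N] dominates [q L] and [|p K|], whatever the sign of [p]. Starting [N] steps back, as [Z] does,
    turns the displacements [- q L] and [- p K] into walks forward of lengths between [0] and
    [2 N]. *)
Let N : int := q%:Z * Num.floor gamma + `|p| * Num.floor beta.
Let Z (x : borelX R) : R := q%:R * beta * gamma * valX x - N%:~R * beta.
Let m1 (x : borelX R) : nat := absz (N - q%:Z * L x)%R.
Let m2 (x : borelX R) : nat := absz (N - p * K x)%R.

Let qL_bounds x : 0 <= q%:Z * L x <= N.
Proof.
have /andP[l0 l1] := floor_mul_valX gamma x (ltW gamma_gt0).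
have k0 : 0 <= Num.floor beta by rewrite floor_ge0 ltW.
rewrite mulr_ge0//= /N -[leLHS]addr0 lerD ?ler_wpM2l// mulr_ge0//.
Qed.

Let pK_bounds x : - N <= p * K x <= N.
Proof.
have /andP[k0 k1] := floor_mul_valX beta x (ltW beta_gt0).
have g0 : 0 <= Num.floor gamma by rewrite floor_ge0 ltW.
rewrite -ler_norml normrM (ger0_norm k0) /N -[leLHS]add0r lerD//.
  exact: mulr_ge0.
by rewrite ler_wpM2l.
Qed.

Let m1E x : (m1 x)%:R = N%:~R - q%:R * (L x)%:~R :> R.
Proof.
have /andP[_ h] := qL_bounds x.
by rewrite /m1 natr_absz ger0_norm ?subr_ge0// rmorphB rmorphM.
Qed.

Let m2E x : (m2 x)%:R = N%:~R - p%:~R * (K x)%:~R :> R.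
Proof.
have /andP[_ h] := pK_bounds x.
by rewrite /m2 natr_absz ger0_norm ?subr_ge0// rmorphB rmorphM.
Qed.

Let hm1 : bounded_length (2 * absz N)%N m1.
Proof.
split; last by move=> x; have := qL_bounds x; rewrite /m1; lia.
apply: (measurableT_comp (@measurable_floor_comp R _ _
  (fun k => absz (N - q%:Z * k)%R)) (g := fun x : borelX R => gamma * valX x)).
by apply: measurable_funM => //; exact: measurable_fun_valX.
Qed.

Let hm2 : bounded_length (2 * absz N)%N m2.
Proof.
split; last by move=> x; have := pK_bounds x; rewrite /m2; lia.
apply: (measurableT_comp (@measurable_floor_comp R _ _
  (fun k => absz (N - p * k)%R)) (g := fun x : borelX R => beta * valX x)).
by apply: measurable_funM => //; exact: measurable_fun_valX.
Qed.

Let mZ : measurable_fun setT Z.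
Proof.
apply: measurable_funB => //; apply: measurable_funM => //.
exact: measurable_fun_valX.
Qed.

(* [q T_beta (T_gamma x)] and [q T_gamma (T_beta x)] have the same law, and
   modulo 1 they are [Z x + m1 x * beta] and [Z x + m2 x * beta]. *)
Let hlaw : same_endpoint_law mu beta Z m1 m2.
Proof.
move=> phi [mphi [C hC]] pphi.
pose f (x : borelX R) := phi (q%:R * valX x).
have mf : measurable_fun setT f.
  apply: (measurableT_comp mphi); apply: measurable_funM => //.
  exact: measurable_fun_valX.
have mfb c : measurable_fun setT (fun x => f (beta_map c x)).
  by apply: measurableT_comp => //; exact: measurable_beta_map.
transitivity (\int[mu]_x f (beta_map beta (beta_map gamma x))).
  apply: eq_Rintegral => x _; rewrite m1E /f.
  pose k := Num.floor (beta * valX (beta_map gamma x)).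
  rewrite -[RHS](pphi _ (q%:Z * k)); congr phi.
  have -> : valX (beta_map beta (beta_map gamma x)) =
      beta * (gamma * valX x - (L x)%:~R) - k%:~R by [].
  by rewrite rmorphM/= /Z -[(q%:Z)%:~R]/(q%:R : R); ring.
transitivity (\int[mu]_x f (beta_map gamma (beta_map beta x))).
  rewrite (integral_beta_map gamma mu (fun x => f (beta_map beta x)) C)//; last by move=> x; exact: hC.
  rewrite (integral_beta_map beta mu f C)//; last by move=> x; exact: hC.
  rewrite (integral_beta_map beta mu (fun x => f (beta_map gamma x)) C)//; last by move=> x; exact: hC.
  by rewrite (integral_beta_map gamma mu f C)//; move=> x; exact: hC.
apply: eq_Rintegral => x _; rewrite m2E /f.
pose k := Num.floor (gamma * valX (beta_map beta x)).
(* By [gammaE], [q gamma K = p K beta + r K]; periodicity absorbs the integer [r K + q k]. *)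
rewrite -[RHS](pphi _ (- (r * K x + q%:Z * k))); congr phi.
have -> : valX (beta_map gamma (beta_map beta x)) =
    gamma * (beta * valX x - (K x)%:~R) - k%:~R by [].
have -> : (- (r * K x + q%:Z * k))%:~R = - (r%:~R * (K x)%:~R + q%:R * k%:~R) :> R.
  by rewrite rmorphN rmorphD !rmorphM.
have -> : q%:R * (gamma * (beta * valX x - (K x)%:~R) - k%:~R) =
  q%:R * beta * gamma * valX x - (q%:R * gamma) * (K x)%:~R - q%:R * k%:~R by ring.
by rewrite gammaE /Z; ring.
Qed.
(** The difference of lengths is [m1 - m2 = p K - q L = q T_gamma x - p T_beta x - r x]. By
    invariance its integral is [(q - p - r)] times the mean of [x], and it is zero by
    [expected_length_eq]. *)
Lemma common_invariant_mean_eq0 : q%:Z != p + r ->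
  \int[mu]_x valX x = 0.
Proof.
move=> pqr; have [E [mE E0 muE]] := musing.
pose a := q%:R * beta * gamma.
have a0 : 0 < a by rewrite !mulr_gt0// ltr0n.
pose B := @valX R @` E; have mB : measurable B by exact: measurable_image_valX.
(* If [y = Z x + j beta - k], then [x = (y + k + (N - j) beta) / a]: each set is the affine copy of
   the null carrier for one pair [k, j]. The index [n] encodes [k]; the default [0] for non-codes
   merely repeats a set. *)
pose S_ (n j : nat) : set R := (fun y => a^-1 * y +
  a^-1 * ((odflt 0 (unpickle n : option int))%:~R + (N%:~R - j%:R) * beta)) @^-1` B.
have mS_ n j : measurable (S_ n j).
  rewrite -[X in measurable X]setTI; apply: (_ : measurable_fun setT _) => //.
  by apply: measurable_funD => //; exact: measurable_funM.
pose S := \bigcup_n \bigcup_j S_ n j.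
have mS : measurable S by do 2 apply: bigcupT_measurable => ?.
have S0 : lebesgue_measure S = 0%E.
  apply/negligibleP; first exact: mS.
  do 2 apply: negligible_bigcup => ?.
  apply/negligibleP; first exact: mS_.
  by apply: lebesgue_null_affine; rewrite ?invr_gt0.
have AS x : E x -> forall j : nat, S (fractional (Z x + j%:R * beta)).
  move=> Ex j; pose k := Num.floor (Z x + j%:R * beta).
  exists (pickle k) => //; exists j => //; exists x => //.
  by rewrite pickleK /= /fractional -/k /Z -/a; field; rewrite gt_eqF.
have := expected_length_eq mu beta _ Z mZ m1 m2 E S beta_irr hm1 hm2 hlaw mE muE mS S0 AS.
have v_le1 (x : borelX R) : `|valX x| <= 1.
  by have /andP[x0 x1] := valX_bounds x; rewrite ger0_norm// ltW.
have ivb c : mu.-integrable setT (EFin \o (fun x => valX (beta_map c x))).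
  apply: (@bounded_integrable _ _ _ _ _ 1) => //.
  apply: measurableT_comp; [exact: measurable_fun_valX|exact: measurable_beta_map].
have iv : mu.-integrable setT (EFin \o @valX R).
  by apply: (@bounded_integrable _ _ _ _ _ 1) => //; exact: measurable_fun_valX.
have iZ (f : borelX R -> R) (c : R) : mu.-integrable setT (EFin \o f) ->
    mu.-integrable setT (EFin \o (fun x => c * f x)).
  by move=> fi; apply: (@integrableZl _ _ _ mu setT measurableT c _ fi).
have iN m M : bounded_length M m ->
    mu.-integrable setT (EFin \o (fun x => (m x)%:R : R)).
  move=> [mm mM]; apply: (@bounded_integrable _ _ _ _ _ M%:R).
    by apply: (measurableT_comp (f := fun n : nat => n%:R : R) (g := m)).
  by move=> x; rewrite normr_nat ler_nat.
move=> /eqP; rewrite -subr_eq0 -RintegralB//; try exact: iN hm1; try exact: iN hm2.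
under eq_Rintegral => x _.
  have -> : (m1 x)%:R - (m2 x)%:R =
      q%:R * valX (beta_map gamma x) - p%:~R * valX (beta_map beta x) - r%:~R * valX x.
    have -> : valX (beta_map gamma x) = gamma * valX x - (L x)%:~R by [].
    have -> : valX (beta_map beta x) = beta * valX x - (K x)%:~R by [].
    by rewrite m1E m2E mulrBr mulrA gammaE; ring.
  over.
have h c : eq_meas (pushforward mu (beta_map c)) mu ->
    \int[mu]_x valX (beta_map c x) = \int[mu]_x valX x.
  move=> hc; apply: (integral_beta_map c mu _ 1) => //.
  exact: measurable_fun_valX.
rewrite !RintegralB// ?RintegralZl//; try exact: iZ.
  rewrite !h// -!mulrBl mulf_eq0 => /orP[|/eqP//].
  rewrite -[q%:R]/((q%:Z)%:~R) -!rmorphB intr_eq0 -addrA -opprD subr_eq0.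
  by rewrite (negbTE pqr).
by apply: (@integrableB _ _ _ mu setT measurableT _ _ (iZ _ q%:R (ivb gamma)) (iZ _ p%:~R (ivb beta))).
Qed.
End common_invariant_measure.

(** * Clearing denominators and concentration at the origin *)

Theorem theorem1p1 (R : realType) (beta gamma : R) (a c : rat)
  (hbeta : 1 < beta) (hirr : irrational beta)
  (hgamma_def : gamma = ratr a * beta + ratr c) (hgamma : 1 < gamma)
  (hac : a + c <> 1)
  (mu : {finite_measure set (borelX R) -> \bar R})
  (hsing : singular mu (@lebX R))
  (hinv_beta : eq_meas (pushforward mu (beta_map beta)) mu)
  (hinv_gamma : eq_meas (pushforward mu (beta_map gamma)) mu) :
  exists t : {nonneg R}, eq_meas mu (mscale t (\d_(zeroX R : borelX R))).
Proof.
have [u [s s0 aE]] : exists u : int, exists2 s : nat, (0 < s)%N & a = u%:~R / s%:R.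
  by have [n d _] := ratP a; exists n, d.+1.
have [v [w w0 cE]] : exists v : int, exists2 w : nat, (0 < w)%N & c = v%:~R / w%:R.
  by have [n d _] := ratP c; exists n, d.+1.
have sR : s%:R != 0 :> R by rewrite pnatr_eq0 -lt0n.
have wR : w%:R != 0 :> R by rewrite pnatr_eq0 -lt0n.
have sQ : s%:R != 0 :> rat by rewrite pnatr_eq0 -lt0n.
have wQ : w%:R != 0 :> rat by rewrite pnatr_eq0 -lt0n.
(* Over the common denominator [s w] the integers are [p = u w] and [r = v s], and [a + c <> 1]
   becomes [q <> p + r]. *)
have gE : (s * w)%N%:R * gamma = (u * w%:Z)%:~R * beta + (v * s%:Z)%:~R.
  rewrite hgamma_def aE cE !fmorph_div/= !ratr_int !ratr_nat !rmorphM/=.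
  rewrite -[(w%:Z)%:~R]/(w%:R : R) -[(s%:Z)%:~R]/(s%:R : R).
  by field; rewrite wR sR.
have mean0 : \int[mu]_x valX x = 0.
  apply: (@common_invariant_mean_eq0 _ beta gamma _ _ (s * w)%N mu _ _ _ hirr gE) => //.
  - exact: lt_trans hbeta.
  - exact: lt_trans hgamma.
  - by rewrite muln_gt0 s0.
  - apply/eqP => h; apply: hac; apply: (mulfI (mulf_neq0 sQ wQ)).
    have h' : s%:R * w%:R = u%:~R * w%:R + v%:~R * s%:R :> rat.
      have := congr1 (fun k : int => k%:~R : rat) h.
      by rewrite /= rmorphD PoszM !rmorphM.
    by rewrite mulr1 [RHS]h' aE cE; field; rewrite sQ wQ.
have m0 : measurable [set zeroX R : borelX R].
  rewrite (_ : [set _] = @valX R @^-1` [set 0]).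
    by rewrite -[X in measurable X]setTI; apply: measurable_fun_valX => //; exact: measurable_set1.
  apply/seteqP; split=> x /= => [->//|h]; exact: valX_inj.
(* A nonnegative function of integral zero vanishes almost everywhere, and [valX] vanishes only at
   the origin. *)
have nonzero_null : mu (~` [set zeroX R : borelX R]) = 0%E.
  have iv : mu.-integrable setT (EFin \o @valX R).
    apply: (@bounded_integrable _ _ _ _ _ 1); first exact: measurable_fun_valX.
    by move=> x; have /andP[x0 x1] := valX_bounds x; rewrite ger0_norm// ltW.
  have mv : measurable_fun setT (EFin \o @valX R) by case/integrableP: iv.
  have [abs0 _] := ae_eq_integral_abs mu measurableT mv.
  have /abs0[N [mN N0 hN]] : (\int[mu]_x `|(EFin \o @valX R) x| = 0)%E.
    under eq_integral => x _.
      have /andP[x0 _] := valX_bounds x.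
      rewrite /= ger0_norm//; over.
    rewrite -[LHS]fineK; last exact: integrable_fin_num.
    by congr EFin; exact: mean0.
  apply: (subset_measure0 _ mN _ N0); first exact: measurableC.
  move=> x x0; apply: hN => /= h; apply: x0; apply: valX_inj.
  by have [] := h I.
(* The weight [t] is the mass of the origin, where all of [mu] sits. *)
have t0 : 0 <= fine (mu [set zeroX R : borelX R]) by apply: fine_ge0.
exists (NngNum t0) => A mA.
have -> : mu A = mu (A `&` [set zeroX R]).
  rewrite -[in LHS](setIT A) -(setUv [set zeroX R : borelX R]) setIUr measureU.
  - rewrite (subset_measure0 _ _ (@subIsetr _ A _) nonzero_null) ?adde0//.
      exact/measurableI/measurableC.
    exact: measurableC.
  - exact: measurableI.
  - exact/measurableI/measurableC.
  - by rewrite setIACA setICr setI0.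
rewrite /mscale/= fineK ?fin_num_measure// diracE.
have [/set_mem A0|A0] := boolP (zeroX R \in A).
  by rewrite mule1 setIidr// => _ ->.
rewrite mule0 (_ : _ `&` _ = set0) ?measure0//; apply/seteqP; split=> // x [Ax x0].
by move/negP: A0; apply; apply/mem_set; rewrite -x0.
Qed.
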